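(* Let $(B,d)$ be a compact metric space, and let $A_n\subset B$ ($n\ge1$) and $A\subset B$ be compact sets with $\lim_{n\to\infty}\delta(A_n,A)=0$, where $\delta$ is the Hausdorff metric. Let $R_n\in\mathcal{RM}(A_n)$ for $n\ge1$, and assume $$\psi_1\big(d(x,y)\big)\le R_n(x,y)\le\psi_2\big(d(x,y)\big),\quad\forall n\ge1,\ \forall x,y\in A_n$$ for some $\psi_1,\psi_2\in C[0,\infty)$ with $\psi_1(0)=\psi_2(0)=0$ and $\psi_2(t)\ge\psi_1(t)>0$ for $t>0$. Then there exist $R\in\mathcal{RM}(A)$ and a subsequence $\{n_k\}_{k\ge1}$ such that $R_{n_k}\rightarrowtail R$. Moreover, $$\psi_1\big(d(x,y)\big)\le R(x,y)\le\psi_2\big(d(x,y)\big),\quad\forall x,y\in A.$$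
   Context: **Hausdorff metric.** $\delta(A,A')=\inf\{\rho>0:A\subset B_\rho(A')\text{ and }A'\subset B_\rho(A)\}$, with $B_\rho(A)=\bigcup_{x\in A}\{y\in B:d(x,y)<\rho\}$. **Resistance metrics.** A resistance form on a finite set $V$ is a quadratic form $\mathcal{E}_V(f)=\frac12\sum_{x\ne y}c_{x,y}(f(x)-f(y))^2$ on the space $l(V)$ of real functions on $V$, with $c_{x,y}=c_{y,x}\in[0,\infty)$, such that $\mathcal{E}_V(f)=0$ iff $f$ is constant. A function $R:X\times X\to\mathbb{R}$ is a resistance metric on a set $X$ if for any finite $V\subset X$ there is a resistance form $\mathcal{E}_V$ on $V$ with $R(x,y)=\sup\{|f(x)-f(y)|^2/\mathcal{E}_V(f):f\in l(V)\text{ nonconstant}\}$ for $x,y\in V$. $\mathcal{RM}(X)$ is the set of resistance metrics on $X$. **Convergence $\rightarrowtail$.** $R_{n_k}\rightarrowtail R$ means: for any $x,y\in A$ and $x_k,y_k\in A_{n_k}$ with $x_k\to x$, $y_k\to y$ in $(B,d)$, $R_{n_k}(x_k,y_k)\to R(x,y)$. *)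

(* Defs.v *)
From mathcomp Require Import all_boot all_order all_algebra.
From mathcomp Require Import finmap.
From mathcomp Require Import all_classical all_reals all_analysis.

Set Implicit Arguments.
Unset Strict Implicit.
Unset Printing Implicit Defensive.

Import Order.TTheory GRing.Theory Num.Theory.
Import numFieldNormedType.Exports.

Local Open Scope classical_set_scope.
Local Open Scope ring_scope.

Section Hausdorff.
Context {K : realType} {B : metricType K}.

Definition fattening (r : K) (A : set B) : set B :=
  \bigcup_(x in A) [set y | mdist x y < r].

(* Extended-real valued: the infimum is +oo when no r qualifies, which happens
   when exactly one of the two sets is empty; [inf] on K would return 0. *)
Definition hausdorff_dist (A A' : set B) : \bar K :=
  ereal_inf [set r%:E | r in
    [set r : K | [/\ 0 < r, A `<=` fattening r A' & A' `<=` fattening r A]]].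

End Hausdorff.

Section Resistance.
Context {K : realType}.

Definition constant_fun (V : finType) (f : {ffun V -> K}) : Prop :=
  exists a : K, forall x, f x = a.

Definition resistance_form (V : finType) (E : {ffun V -> K} -> K) : Prop :=
  exists c : V -> V -> K,
    [/\ forall x y, c x y = c y x,
        forall x y, 0 <= c x y,
        forall f, E f =
          2^-1 * \sum_x \sum_(y | x != y) c x y * (f x - f y) ^+ 2
      & forall f, E f = 0 <-> constant_fun f].

(* [sup set0 = 0], the convention for a supremum of nonnegative quantities; it
   is needed when V is a singleton, where R x x = 0. For a resistance form on a
   V with at least two points, the set is nonempty and bounded. *)
Definition resistance_of (V : finType) (E : {ffun V -> K} -> K) (x y : V) : K :=
  sup [set `|f x - f y| ^+ 2 / E f | f in
    [set f : {ffun V -> K} | ~ constant_fun f]].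

(* A function X * X -> K is represented by a total R : T -> T -> K, whose values
   outside of X are irrelevant. *)
Definition resistance_metric (T : choiceType) (X : set T) (R : T -> T -> K) :
    Prop :=
  forall V : {fset T}, [set` V] `<=` X ->
    exists2 E : {ffun V -> K} -> K, resistance_form E &
      forall x y : V, R (val x) (val y) = resistance_of E x y.

End Resistance.

(* The k-th metric of the sequence lives on A_ k; a subsequence is passed as
   [A_ \o n_] and [R_ \o n_]. *)
Definition res_converges (K : realType) (B : metricType K)
    (A_ : nat -> set B) (R_ : nat -> B -> B -> K)
    (A : set B) (R : B -> B -> K) : Prop :=
  forall (x y : B) (x_ y_ : nat -> B),
    A x -> A y -> (forall k, A_ k (x_ k)) -> (forall k, A_ k (y_ k)) ->
    x_ @ \oo --> x -> y_ @ \oo --> y ->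
    R_ k (x_ k) (y_ k) @[k --> \oo] --> R x y.

(* Main.v *)
Require Import Defs.
From mathcomp Require Import all_boot all_order all_algebra.
From mathcomp Require Import finmap.
From mathcomp Require Import all_classical all_reals all_analysis.
From mathcomp Require Import ring lra.

Import Order.TTheory GRing.Theory Num.Theory.
Import numFieldNormedType.Exports.

Local Open Scope classical_set_scope.
Local Open Scope ring_scope.

(** Write [S_n] for the square root of [R_n]. The variational description
    of resistance, [(f x - f y)^2 <= R_n x y * E f] with the best constant,
    shows that [S_n] satisfies the triangle inequality
    ([sqrt_resistance_metric_triangle]), and the upper bound by [psi2] shows
    that [S_n x y] is small, uniformly in [n], when [x] and [y] are close. The
    [S_n] are thus equicontinuous, and an argument of Arzela-Ascoli type gives
    a limit.

    Instead of extracting subsequences successively, fix an ultrafilter [U] on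
    the natural numbers that refines the filter of cofinite sets. Hausdorff
    convergence approximates each [x] in [A] by points [p x n] of [A_ n], and
    [R x y] is the limit along [U] of [R_n (p x n) (p y n)], which is eventually
    bounded by [psi2 (mdist x y) + 1]. Equicontinuity and the compactness of
    [A * A] make the convergence of [S_n] to the root of [R] uniform along [U]
    ([uniform_limit]); since each member of [U] is infinite, one strictly
    increasing sequence of indices eventually satisfies each of these uniform
    estimates ([diagonal_subsequence]).

    It remains to see that [R] is a resistance metric, that is, that on a finite
    set a limit of resistance metrics is one when it separates points
    ([ultralimit_resistance]). A conductance is at most twice the inverse of the
    resistance between its endpoints, so the conductances stay bounded and
    converge along [U]. The inequality
    [(f x - f y)^2 <= R x y * E f] passes to the limit; it shows both that the
    limit energy vanishes only on constants and that its resistance is at most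
    [R]. For the other inequality, functions that are nearly optimal for the
    approximating forms, normalized to be [0] at [x] and [1] at [y], are
    bounded, and their limit is nearly optimal for the limit form. *)

(** * Energies and resistances on a finite set *)

Section FiniteForms.
Context {K : realType} {V : finType}.
Implicit Types (c : V -> V -> K) (E : {ffun V -> K} -> K) (f : {ffun V -> K}).

Definition energy c f : K :=
  2^-1 * \sum_x \sum_(y | x != y) c x y * (f x - f y) ^+ 2.

Lemma energy_ge0 c f : (forall x y, 0 <= c x y) -> 0 <= energy c f.
Proof.
move=> c0; apply: mulr_ge0; first by rewrite invr_ge0.
by apply: sumr_ge0 => x _; apply: sumr_ge0 => y _; rewrite mulr_ge0// sqr_ge0.
Qed.

(** Energy and squared oscillation scale alike, so a function that separates
    two points may be normalized to be 0 at one and 1 at the other. *)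
Lemma energy_affine c f (a b : K) :
  energy c [ffun z => a * (f z - b)] = a ^+ 2 * energy c f.
Proof.
rewrite /energy mulrCA; congr (_ * _); rewrite mulr_sumr.
apply: eq_bigr => x _; rewrite mulr_sumr; apply: eq_bigr => y _.
by rewrite !ffunE; ring.
Qed.

Lemma energy_constant c f : constant_fun f -> energy c f = 0.
Proof.
move=> [a fa]; rewrite /energy big1 ?mulr0// => x _.
by rewrite big1// => y _; rewrite !fa subrr expr0n mulr0.
Qed.

(** One edge carries only part of the energy. This is what bounds conductances
    in terms of resistances; the factor 2 is not optimal, as the term of the
    reversed edge is dropped. *)
Lemma conductance_le_energy c f x y : (forall x y, 0 <= c x y) -> x != y ->
  c x y * (f x - f y) ^+ 2 <= 2 * energy c f.
Proof.
move=> c0 xy; rewrite /energy mulVKf ?pnatr_eq0//.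
rewrite (bigD1 x)//= (bigD1 y)//= -addrA lerDl addr_ge0//.
  by apply: sumr_ge0 => z _; rewrite mulr_ge0// sqr_ge0.
apply: sumr_ge0 => z _; apply: sumr_ge0 => t _.
by rewrite mulr_ge0// sqr_ge0.
Qed.

Lemma resistance_form_ge0 {E} f : resistance_form E -> 0 <= E f.
Proof. by move=> [c [_ c0 -> _]]; exact: energy_ge0. Qed.

Lemma resistance_form_gt0 {E f} : resistance_form E -> ~ constant_fun f ->
  0 < E f.
Proof.
move=> rE fN; rewrite lt_neqAle resistance_form_ge0// andbT eq_sym.
by apply/negP => /eqP; case: rE => c [_ _ _ ->].
Qed.

Lemma resistance_of_ge0 {E x y} : resistance_form E -> 0 <= resistance_of E x y.
Proof.
move=> rE; rewrite /resistance_of; set S := (X in sup X).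
have [hS|hS] := pselect (has_sup S); last by rewrite sup_out.
have [[z Sz] _] := hS; apply: le_trans (sup_upper_bound hS Sz).
move: Sz => [f _ <-].
by apply: divr_ge0; [exact: sqr_ge0|exact: resistance_form_ge0].
Qed.

(** Together with the next two lemmas, this replaces the supremum that defines
    the resistance by inequalities between quadratic forms, which are stable
    under limits. *)
Lemma resistance_of_le {E x y} (M : K) : resistance_form E -> 0 <= M ->
  (forall f, (f x - f y) ^+ 2 <= M * E f) -> resistance_of E x y <= M.
Proof.
move=> rE M0 fM; rewrite /resistance_of; set S := (X in sup X).
have [hS|hS] := pselect (has_sup S); last by rewrite sup_out.
apply: ge_sup; first by case: hS.
move=> _ [f fN <-]; rewrite ler_pdivrMr ?resistance_form_gt0//.
by rewrite real_normK ?num_real.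
Qed.

(** A nonzero resistance is a genuine supremum, because the supremum of an
    empty or unbounded set is 0 by convention: positivity alone provides the
    boundedness of the quotients. *)
Lemma sqr_osc_le_resistance {E x y} f : resistance_form E ->
  0 < resistance_of E x y -> (f x - f y) ^+ 2 <= resistance_of E x y * E f.
Proof.
move=> rE r0.
have [[a fa]|fN] := pselect (constant_fun f).
  rewrite !fa subrr expr0n/= mulr_ge0 ?resistance_form_ge0//.
  exact: ltW.
rewrite -ler_pdivrMr ?resistance_form_gt0//.
rewrite -[(f x - f y) ^+ 2]real_normK ?num_real//.
apply: sup_upper_bound; last by exists f.
apply: contrapT => /sup_out S0; move: r0.
by rewrite /resistance_of S0 ltxx.
Qed.

Lemma resistance_of_ge {E x y f} (M : K) : resistance_form E ->
  (forall f, (f x - f y) ^+ 2 <= M * E f) ->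
  ~ constant_fun f -> (f x - f y) ^+ 2 / E f <= resistance_of E x y.
Proof.
move=> rE fM fN; rewrite -[(f x - f y) ^+ 2]real_normK ?num_real//.
apply: sup_upper_bound; last by exists f.
split; first by exists (`|f x - f y| ^+ 2 / E f), f.
exists M => _ [g gN <-]; rewrite ler_pdivrMr ?resistance_form_gt0//.
by rewrite real_normK ?num_real.
Qed.

Lemma resistance_of_xx {E x} : resistance_form E -> resistance_of E x x = 0.
Proof.
move=> rE; apply/eqP; rewrite eq_le resistance_of_ge0// andbT.
by apply: resistance_of_le => // f; rewrite subrr expr0n mul0r.
Qed.

(** The normalization makes near-optimal functions for varying forms
    comparable, so that they have a common bound. *)
Lemma resistance_of_near_optimal {E x y} {s : K} : resistance_form E ->
  0 < s -> s < resistance_of E x y ->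
  exists g : {ffun V -> K}, [/\ g x = 0, g y = 1 & s * E g < 1].
Proof.
move=> rE s0 sr.
have hS : has_sup [set `|f x - f y| ^+ 2 / E f | f in
    [set f : {ffun V -> K} | ~ constant_fun f]].
  apply: contrapT => /sup_out S0; move: sr.
  by rewrite /resistance_of S0 ltNge ltW.
have e0 : 0 < resistance_of E x y - s by rewrite subr_gt0.
have [_ [f fN <-]] := sup_adherent e0 hS.
rewrite subKr ltr_pdivlMr ?resistance_form_gt0// real_normK ?num_real// => sf.
have fxy : f y - f x != 0.
  rewrite subr_eq0; apply/eqP => fxy; move: sf.
  rewrite fxy subrr expr0n/=; apply/negP; rewrite -leNgt mulr_ge0//.
    exact: ltW.
  exact: resistance_form_ge0.
exists [ffun z => (f y - f x)^-1 * (f z - f x)]; split.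
- by rewrite ffunE subrr mulr0.
- by rewrite ffunE mulVf.
have [c [_ _ Ec _]] := rE.
rewrite Ec -/(energy _ _) energy_affine exprVn mulrCA mulrC ltr_pdivrMr.
  by rewrite mul1r /energy -Ec -(sqrrN (f y - f x)) opprB.
by rewrite lt_neqAle sqr_ge0 andbT eq_sym expf_eq0.
Qed.

(** The oscillation of [f] between two points is at most [Num.sqrt (E f)] times
    the root of their resistance, and oscillations add up along
    [x], [y], [z]. *)
Lemma sqrt_resistance_triangle {E x y z} : resistance_form E ->
  (forall x y, x != y -> 0 < resistance_of E x y) ->
  Num.sqrt (resistance_of E x z) <=
  Num.sqrt (resistance_of E x y) + Num.sqrt (resistance_of E y z).
Proof.
move=> rE rpos.
have osc u v f :
      `|f u - f v| <= Num.sqrt (resistance_of E u v) * Num.sqrt (E f).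
  rewrite -sqrtrM ?resistance_of_ge0// -sqrtr_sqr ler_wsqrtr//.
  have [->|uv] := eqVneq u v; last exact/sqr_osc_le_resistance/rpos.
  by rewrite subrr expr0n mulr_ge0 ?resistance_of_ge0 ?resistance_form_ge0.
set a := Num.sqrt (resistance_of E x y).
set b := Num.sqrt (resistance_of E y z).
have ab0 : 0 <= a + b by rewrite addr_ge0 ?sqrtr_ge0.
rewrite -[leRHS]ger0_norm// -sqrtr_sqr ler_wsqrtr//.
apply: resistance_of_le => //; first exact: sqr_ge0.
move=> f; rewrite -[E f]sqr_sqrtr ?resistance_form_ge0// -exprMn.
rewrite -[leLHS]real_normK ?num_real// lerXn2r ?nnegrE ?mulr_ge0 ?sqrtr_ge0//.
rewrite -(subrKA (f y)) mulrDl (le_trans (ler_normD _ _))// lerD//; exact: osc.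
Qed.

End FiniteForms.

(** * Limits of resistances along an ultrafilter *)

Section UltrafilterLimits.
Context {K : realType} {T : Type} {U : set_system T} {UU : UltraFilter U}.

Lemma ultra_bounded_cvg (u : T -> K) (M : K) :
  (\forall t \near U, `|u t| <= M) -> exists l : K, u t @[t --> U] --> l.
Proof.
move=> uM.
have uMM : (u @ U) `[- M, M]%classic.
  by apply: filterS uM => t; rewrite /= in_itv/= ler_norml.
have [l [_ ul]] := segment_compact _ uMM.
exists l => N lN; have [//|uN] := in_ultra_setVsetC (u @^-1` N) UU.
by have [z []] := ul (~` N) N uN lN.
Qed.

Context {V : finType}.

Lemma cvg_energy (c_ : T -> V -> V -> K) (c : V -> V -> K)
    (f_ : T -> {ffun V -> K}) (f : {ffun V -> K}) :
  (forall x y, x != y -> c_ t x y @[t --> U] --> c x y) ->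
  (forall x, f_ t x @[t --> U] --> f x) ->
  energy (c_ t) (f_ t) @[t --> U] --> energy c f.
Proof.
move=> cc ff; apply: cvgM; first exact: cvg_cst.
apply: cvg_big => [|x _]; first exact: add_continuous.
apply: cvg_big => [|y xy]; first exact: add_continuous.
apply: cvgM; first exact: cc.
have fxy : f_ t x - f_ t y @[t --> U] --> f x - f y by exact: cvgB.
by rewrite expr2; under eq_fun do rewrite expr2; exact: cvgM.
Qed.

(** The hypothesis [0 < r x y] keeps the conductances bounded and forces the
    limit energy to vanish on constants only. *)
Lemma ultralimit_resistance (r_ : T -> V -> V -> K) (r : V -> V -> K) :
  (\forall t \near U, exists2 E : {ffun V -> K} -> K, resistance_form E &
    forall x y, r_ t x y = resistance_of E x y) ->
  (forall x y, r_ t x y @[t --> U] --> r x y) ->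
  (forall x y, x != y -> 0 < r x y) ->
  exists2 E : {ffun V -> K} -> K, resistance_form E &
    forall x y, r x y = resistance_of E x y.
Proof.
move=> rE rr rpos.
pose good t (c : V -> V -> K) := [/\ forall x y, c x y = c y x,
  forall x y, 0 <= c x y, resistance_form (energy c) &
  forall x y, r_ t x y = resistance_of (energy c) x y].
have /choice[c_ c_good] t : exists c, (exists2 E : {ffun V -> K} -> K,
    resistance_form E & forall x y, r_ t x y = resistance_of E x y) -> good t c.
  have [[E fE rtE]|noE] := pselect (exists2 E : {ffun V -> K} -> K,
    resistance_form E & forall x y, r_ t x y = resistance_of E x y); last first.
    by exists (fun _ _ => 0).
  have [c [csym c0 Ec _]] := fE; exists c => _.
  have EE : E = energy c by apply/funext => f; exact: Ec.
  by rewrite /good -EE.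
have {c_good}good_c_ : \forall t \near U, good t (c_ t).
  by apply: filterS rE => t; exact: c_good.
have r_ge0 x y : 0 <= r x y.
  apply: (cvgr_to_ge (rr x y)).
  by apply: filterS good_c_ => t [_ _ fE ->]; exact: resistance_of_ge0.
(* Eventually [r x y / 2 < r_ t x y], and each energy gives
   [c_ t x y * r_ t x y <= 2]. *)
have c_cvg x y : x != y -> exists l : K, c_ t x y @[t --> U] --> l.
  move=> xy; apply: (@ultra_bounded_cvg _ (2 / (r x y / 2))).
  have r2 : r x y / 2 < r x y by have := rpos _ _ xy; lra.
  near=> t.
  have [_ c0 fE rtE] : good t (c_ t) by near: t.
  have rt : r x y / 2 < r_ t x y by near: t; exact: (cvgr_gt _ (rr x y)).
  have rt0 : 0 < r_ t x y by rewrite (lt_trans _ rt)// divr_gt0 ?rpos.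
  rewrite ger0_norm// ler_pdivlMr ?divr_gt0 ?rpos//.
  apply: (@le_trans _ _ (c_ t x y * r_ t x y)).
    by rewrite ler_wpM2l// ltW.
  have [->|cN0] := eqVneq (c_ t x y) 0; first by rewrite mul0r.
  have cp : 0 < c_ t x y by rewrite lt_neqAle eq_sym cN0 c0.
  rewrite mulrC -ler_pdivlMr// rtE; apply: resistance_of_le => //.
    by rewrite divr_ge0.
  move=> f; rewrite mulrAC ler_pdivlMr// mulrC.
  exact: conductance_le_energy.
(* The conductances [c_ t x x] do not contribute to the energy and need not
   converge, hence the value 0 on the diagonal. *)
have /choice[c cP] (p : V * V) : exists l : K,
    (p.1 = p.2 -> l = 0) /\ (p.1 != p.2 -> c_ t p.1 p.2 @[t --> U] --> l).
  have [pp|/[dup] pp /c_cvg[l cl]] := eqVneq p.1 p.2; first by exists 0.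
  by exists l; split => // /eqP; rewrite (negbTE pp).
have c_lim x y : x != y -> c_ t x y @[t --> U] --> c (x, y).
  exact: (cP (x, y)).2.
have csym x y : c (x, y) = c (y, x).
  have [->//|xy] := eqVneq x y.
  apply: (@cvg_unique _ _ (c_ t x y @[t --> U])); [exact: norm_hausdorff| |].
    exact: c_lim.
  rewrite eq_sym in xy; apply: cvg_trans (c_lim _ _ xy).
  by apply: near_eq_cvg; apply: filterS good_c_ => t [-> _ _ _].
have c0 x y : 0 <= c (x, y).
  have [<-|xy] := eqVneq x y; first by rewrite (cP (x, x)).1.
  apply: (cvgr_to_ge (c_lim _ _ xy)).
  by apply: filterS good_c_ => t [_ + _ _]; exact.
pose E := energy (fun x y => c (x, y)).
have oscE (f : {ffun V -> K}) x y : (f x - f y) ^+ 2 <= r x y * E f.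
  have [->|xy] := eqVneq x y.
    by rewrite subrr expr0n/= mulr_ge0 ?energy_ge0.
  have lim_rE : r_ t x y * energy (c_ t) f @[t --> U] --> r x y * E f.
    by apply: cvgM; [exact: rr|apply: cvg_energy => // z; exact: cvg_cst].
  apply: (cvgr_to_ge lim_rE).
  near=> t.
  have [_ _ fE rtE] : good t (c_ t) by near: t.
  rewrite rtE; apply: sqr_osc_le_resistance => //; rewrite -rtE.
  by near: t; exact: (cvgr_gt _ (rr x y)) (rpos _ _ xy).
have fE : resistance_form E.
  exists (fun x y => c (x, y)); split => // f.
  split; last exact: energy_constant.
  move=> Ef0; have [x0 _|V0] := pickP (@predT V).
    exists (f x0) => x; apply/eqP; rewrite -subr_eq0 -sqrf_eq0 eq_le sqr_ge0.
    by rewrite andbT (le_trans (oscE _ _ _))// [E f]Ef0 mulr0.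
  by exists 0 => x; have := V0 x.
exists E => // x y; apply/eqP; rewrite eq_le; apply/andP; split; last first.
  exact: resistance_of_le.
have [<-|xy] := eqVneq x y.
  rewrite resistance_of_xx//; apply: (cvgr_to_le (rr x x)).
  by apply: filterS good_c_ => t [_ _ fEt ->]; rewrite resistance_of_xx.
(* Otherwise some [s] lies strictly between the resistance of the limit form
   and [r x y]. Functions [g_ t] with quotient above [s] for the approximating
   forms have a limit [g] whose quotient for [E] is still at least [s]. *)
rewrite leNgt; apply/negP => r_lt.
have [s /andP[sE sr]] : exists s, resistance_of E x y < s < r x y.
  by exists ((resistance_of E x y + r x y) / 2); rewrite !(midf_lt r_lt).
have s0 : 0 < s by rewrite (le_lt_trans _ sE)// resistance_of_ge0.
have /choice[g_ g_opt] t : exists g : {ffun V -> K}, s < r_ t x y ->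
    good t (c_ t) -> [/\ g x = 0, g y = 1 & s * energy (c_ t) g < 1].
  have [srt|] := pselect (s < r_ t x y); last by exists [ffun=> 0].
  have [[? ? fEt rtE]|] := pselect (good t (c_ t)); last by exists [ffun=> 0].
  rewrite rtE in srt.
  by have [g gP] := resistance_of_near_optimal fEt s0 srt; exists g.
have {g_opt}g_opt : \forall t \near U,
    [/\ g_ t x = 0, g_ t y = 1 & s * energy (c_ t) (g_ t) < 1].
  apply: filterS2 good_c_ (cvgr_gt _ (rr x y) _ sr) => t gt st; exact: g_opt.
have /choice[h hP] z : exists l : K, g_ t z @[t --> U] --> l.
  have [->|zx] := eqVneq z x.
    by exists 0; apply: cvg_near_cst; apply: filterS g_opt => t [].
  apply: (@ultra_bounded_cvg _ (1 + (r z x + 1) / s)).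
  near=> t.
  have [gx gy gE] : [/\ g_ t x = 0, g_ t y = 1 & s * energy (c_ t) (g_ t) < 1].
    by near: t.
  have [_ ct0 fEt rtE] : good t (c_ t) by near: t.
  have rzx : r_ t z x < r z x + 1.
    by near: t; apply: (cvgr_lt _ (rr z x)); rewrite ltrDl.
  have r0 : 0 <= r_ t z x by rewrite rtE resistance_of_ge0.
  have rt0 : 0 < r_ t z x by near: t; exact: (cvgr_gt _ (rr z x)) (rpos _ _ zx).
  have : (g_ t z) ^+ 2 <= (r z x + 1) / s.
    rewrite ler_pdivlMr// -[g_ t z]subr0 -gx.
    have := @sqr_osc_le_resistance _ _ _ z x (g_ t) fEt.
    rewrite -rtE => /(_ rt0) osc.
    have E0 : 0 <= energy (c_ t) (g_ t) by exact: energy_ge0.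
    apply: (@le_trans _ _ (r_ t z x * (s * energy (c_ t) (g_ t)))).
      by rewrite mulrCA [leRHS]mulrC ler_wpM2r// ltW.
    by rewrite (le_trans _ (ltW rzx))// ler_piMr// ltW.
  set b := _ / s; rewrite -real_normK ?num_real//.
  have := normr_ge0 (g_ t z); set a := `|_|; clearbody a b => a0 ab.
  have [a1|a1] := leP a 1; first by nra.
  by nra.
pose g := [ffun z => h z].
have gx : g x = 0.
  rewrite ffunE; apply: cvg_unique (hP x) _; first exact: norm_hausdorff.
  by apply: cvg_near_cst; apply: filterS g_opt => t [].
have gy : g y = 1.
  rewrite ffunE; apply: cvg_unique (hP y) _; first exact: norm_hausdorff.
  by apply: cvg_near_cst; apply: filterS g_opt => t [].
have gN : ~ constant_fun g.
  by move=> [a ga]; move/eqP: gy; rewrite ga -(ga x) gx eq_sym oner_eq0.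
have sE1 : s * E g <= 1.
  have lim_sE : s * energy (c_ t) (g_ t) @[t --> U] --> s * E g.
    apply: cvgM; first exact: cvg_cst.
    by apply: cvg_energy => // z; rewrite ffunE; exact: hP.
  by apply: (cvgr_to_le lim_sE); apply: filterS g_opt => t [_ _ /ltW].
have := resistance_of_ge (r x y) fE (fun f => oscE f x y) gN.
rewrite gx gy sub0r sqrrN expr1n.
apply/negP; rewrite -ltNge (lt_le_trans sE)//.
by rewrite ler_pdivlMr ?resistance_form_gt0.
Unshelve. all: by end_near. Qed.

End UltrafilterLimits.

(** * Resistance metrics seen on finite families of points *)

Section Transport.
Context {K : realType}.

Lemma resistance_form_bij {V W : finType} (phi : V -> W) (psi : W -> V)
    (E : {ffun W -> K} -> K) : cancel phi psi -> cancel psi phi ->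
  resistance_form E ->
  let E' f := E [ffun w => f (psi w)] in
  resistance_form E' /\
  forall x y : V, resistance_of E' x y = resistance_of E (phi x) (phi y).
Proof.
move=> phiK psiK [c [csym c0 Ec E0]] E'.
have const (f : {ffun V -> K}) :
    constant_fun [ffun w => f (psi w)] <-> constant_fun f.
  split=> -[a fa]; exists a => x; last by rewrite ffunE.
  by rewrite -(phiK x); have := fa (phi x); rewrite ffunE.
split.
  exists (fun x y => c (phi x) (phi y)); split => // f; last by rewrite E0.
  rewrite /E' Ec; congr (_ * _).
  rewrite (reindex phi)/=; last by exists psi => w _; rewrite ?phiK ?psiK.
  apply: eq_bigr => x _.
  rewrite (reindex phi)/=; last by exists psi => w _; rewrite ?phiK ?psiK.
  apply: eq_big => [y|y _]; first by rewrite (can_eq phiK).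
  by rewrite !ffunE !phiK.
move=> x y; congr sup; apply/seteqP; split => _ [f /= fN <-].
  exists [ffun w => f (psi w)]; first by rewrite /= const.
  by rewrite !ffunE !phiK.
have ff : [ffun w => [ffun x => f (phi x)] (psi w)] = f.
  by apply/ffunP => w; rewrite !ffunE psiK.
exists [ffun x => f (phi x)]; last by rewrite /E' ff !ffunE.
by rewrite /= -const ff.
Qed.

(** The points [p x n] that approximate a finite set move with [n]; indexing
    their resistance forms by a fixed finite type lets these forms have a
    limit. *)
Lemma resistance_metric_family {T : choiceType} {X : set T} {R : T -> T -> K}
    {V : finType} (q : V -> T) :
  resistance_metric X R -> injective q -> (forall v, X (q v)) ->
  exists2 E : {ffun V -> K} -> K, resistance_form E &
    forall v w, R (q v) (q w) = resistance_of E v w.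
Proof.
move=> rR qI qX.
pose W := [fset q v | v in V]%fset.
have qW v : q v \in W by rewrite in_imfset.
have [E fE RE] : exists2 E : {ffun W -> K} -> K, resistance_form E &
    forall x y : W, R (val x) (val y) = resistance_of E x y.
  by apply: rR => _ /imfsetP[v _ ->]; exact: qX.
pose phi v : W := [` qW v]%fset.
have /choice[psi psiP] (w : W) : exists v, q v = val w.
  by have /imfsetP[v _ ->] := valP w; exists v.
have phiK : cancel phi psi by move=> v; apply: qI; rewrite psiP.
have psiK : cancel psi phi by move=> w; apply: val_inj; rewrite /= psiP.
have [fE' resE'] := resistance_form_bij phi psi E phiK psiK fE.
eexists; first exact: fE'.
by move=> v w; rewrite resE' -RE.
Qed.

Lemma sqrt_resistance_metric_triangle {T : choiceType} {X : set T}
    {R : T -> T -> K} {x y z : T} : resistance_metric X R ->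
  (forall x y, X x -> X y -> x != y -> 0 < R x y) -> X x -> X y -> X z ->
  Num.sqrt (R x z) <= Num.sqrt (R x y) + Num.sqrt (R y z).
Proof.
move=> rR Rpos Xx Xy Xz; pose V := [fset x; y; z]%fset.
have VX : [set` V] `<=` X by move=> t; rewrite /= !inE => /orP[/orP[]|] /eqP->.
have [E fE RE] := rR V VX.
have xV : x \in V by rewrite !inE eqxx.
have yV : y \in V by rewrite !inE eqxx orbT.
have zV : z \in V by rewrite !inE eqxx orbT.
have := RE [` xV]%fset [` zV]%fset; have := RE [` yV]%fset [` zV]%fset.
have := RE [` xV]%fset [` yV]%fset => /= -> -> ->.
apply: sqrt_resistance_triangle => // u v uv; rewrite -RE.
by apply: Rpos => //; apply: VX; exact: valP.
Qed.

End Transport.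

(** * Subsequences and limits in metric spaces *)

(** A filter that refines [\oo] has only infinite members, so the finitely many
    conditions [G j], [j <= k], can be met at an index beyond the previous
    one. *)
Lemma diagonal_subsequence (F : set_system nat) (G : nat -> set nat) :
  ProperFilter F -> \oo `<=` F -> (forall j, F (G j)) ->
  exists2 n_ : nat -> nat, {homo n_ : i j / (i < j)%N} &
    forall j k, (j <= k)%N -> G j (n_ k).
Proof.
move=> FF Foo FG.
have /choice[f fP] (km : nat * nat) : exists n, (km.2 < n)%N /\
    forall j, (j <= km.1)%N -> G j n.
  have F1 : \forall n \near F, forall j : 'I_km.1.+1, G j n.
    by apply: filter_forall => j; exact: FG.
  have F2 : \forall n \near F, (km.2 < n)%N by apply: Foo; exact: nbhs_infty_gt.
  have [n [Gn mn]] := filter_ex (filterI F1 F2).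
  by exists n; split => // j jk; exact: (Gn (Ordinal (jk : (j < km.1.+1)%N))).
pose n_ := fix n_ k := if k is k'.+1 then f (k, n_ k') else f (0%N, 0%N).
exists n_.
  by apply: homo_ltn => [? ? ?|k]; [exact: ltn_trans|exact: (fP (k.+1, _)).1].
by move=> j [|k] jk; apply: (fP (_, _)).2.
Qed.

Section HalfLine.
Context {K : realType}.

Lemma cvg_within_halfline {T : Type} {F : set_system T} {FF : Filter F}
    (psi : K -> K) (t_ : T -> K) (t : K) :
  {within `[0, +oo[, continuous psi} -> 0 <= t -> (forall s, 0 <= t_ s) ->
  t_ s @[s --> F] --> t -> psi (t_ s) @[s --> F] --> psi t.
Proof.
move=> /(_ t) psic t0 t_0 tt.
have tI : `[0, +oo[%classic t by rewrite /= in_itv/= t0.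
have {}psic : psi x @[x --> within `[0, +oo[%classic (nbhs t)] --> psi t.
  by rewrite (nbhs_subspace_in tI).
apply: (@cvg_comp _ _ _ t_ psi _ _ _ _ psic) => N wN.
apply: (@filterS _ F _ [set s | `[0, +oo[%classic (t_ s) -> N (t_ s)]).
  by move=> s; apply; rewrite /= in_itv/= t_0.
exact: (tt [set x | `[0, +oo[%classic x -> N x] wN).
Qed.

Lemma halfline_continuous_near0 (psi : K -> K) (e : K) :
  {within `[0, +oo[, continuous psi} -> psi 0 = 0 -> 0 < e ->
  exists2 d, 0 < d & forall t, 0 <= t -> t < d -> psi t < e.
Proof.
move=> psic psi0 e0.
have : psi `|t| @[t --> (0 : K)] --> psi 0.
  apply: cvg_within_halfline => //.
  by have := @norm_continuous K K^o 0; rewrite /continuous_at normr0.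
rewrite psi0 => /cvgr_lt/(_ _ e0)/nbhs_ballP[d /= d0 dP].
exists d => // t t0 td; rewrite -(ger0_norm t0); apply: dP.
by rewrite /ball/= sub0r normrN ger0_norm.
Qed.

End HalfLine.

Section MetricLimits.
Context {K : realType} {B : metricType K}.

Lemma cvg_mdistP {T : Type} {F : set_system T} {FF : Filter F}
    (x_ : T -> B) (x : B) : x_ t @[t --> F] --> x <->
  forall d, 0 < d -> \forall t \near F, mdist x (x_ t) < d.
Proof.
rewrite cvg_ballP; split => xx d d0; move: (xx _ d0); apply: filterS => t;
  by rewrite ballEmdist.
Qed.

Lemma cvg_mdist {T : Type} {F : set_system T} {FF : Filter F}
    (x_ y_ : T -> B) (x y : B) :
  x_ t @[t --> F] --> x -> y_ t @[t --> F] --> y ->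
  mdist (x_ t) (y_ t) @[t --> F] --> mdist x y.
Proof.
move=> /cvg_mdistP xx /cvg_mdistP yy; apply/cvgrPdist_lt => e e0.
have e2 : 0 < e / 2 by rewrite divr_gt0.
apply: filterS2 (xx _ e2) (yy _ e2) => t xt yt.
have := metric_triangle x (x_ t) y; have := metric_triangle (x_ t) (y_ t) y.
have := metric_triangle (x_ t) x (y_ t); have := metric_triangle x y (y_ t).
rewrite (metric_sym (y_ t) y) (metric_sym (x_ t) x) ltr_norml; lra.
Qed.

Lemma hausdorff_dist_ge0 (A A' : set B) : (0 <= hausdorff_dist A A')%E.
Proof. by apply/ereal_infP => _ [r [r0 _ _] <-]; rewrite lee_fin ltW. Qed.

(** The approximation error is [hausdorff_dist (A_ n) A] plus [n.+1%:R^-1],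
    which accounts for the infimum not being attained. The distance may be
    infinite for the first few [n], namely when [A_ n] is empty. *)
Lemma hausdorff_cvg_approx (A_ : nat -> set B) (A : set B) (x : B) :
  hausdorff_dist (A_ n) A @[n --> \oo] --> 0%E -> A x ->
  exists2 p : nat -> B, (\forall n \near \oo, A_ n (p n)) &
    p n @[n --> \oo] --> x.
Proof.
move=> AA Ax; pose h n := hausdorff_dist (A_ n) A.
have h_lt e : 0 < e -> \forall n \near \oo, (h n < e%:E)%E.
  move=> e0; have nb : nbhs (0%E : \bar K) [set u | (u < e%:E)%E].
    by apply: open_ereal_lt'; rewrite lte_fin.
  exact: (AA _ nb).
have /choice[p pP] n : exists y, h n \is a fin_num ->
    A_ n y /\ ((mdist x y)%:E < h n + (n.+1%:R^-1)%:E)%E.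
  have [hfin|] := boolP (h n \is a fin_num); last by exists x.
  have n0 : 0 < n.+1%:R^-1 :> K by rewrite invr_gt0.
  have [_ [r [r0 _ Ar] <-] rh] := lb_ereal_inf_adherent n0 hfin.
  have [y Any yx] := Ar _ Ax; exists y => _; split => //.
  by rewrite metric_sym (lt_trans _ rh)// lte_fin.
have hfin : \forall n \near \oo, h n \is a fin_num.
  apply: filterS (h_lt _ ltr01) => n h1.
  by rewrite ge0_fin_numE ?hausdorff_dist_ge0// (lt_trans h1)// ltry.
exists p; first by apply: filterS hfin => n /pP[].
apply/cvg_mdistP => d d0; have d2 : 0 < d / 2 by rewrite divr_gt0.
apply: filterS3 hfin (h_lt _ d2) (near_infty_natSinv_lt (PosNum d2)).
move=> n /[dup] hn /pP[_]; rewrite -(fineK hn) -EFinD !lte_fin /= => pn hd nd.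
by rewrite (lt_trans pn)// [ltRHS]splitr ltrD.
Qed.

End MetricLimits.

(** * Equicontinuous limits on varying compact sets *)

Section UniformConvergence.
Context {K : realType} {B : metricType K} {F : set_system nat}
  {FF : ProperFilter F} {A_ : nat -> set B} {A : set B}
  {S_ : nat -> B -> B -> K} {S : B -> B -> K} {p : B -> nat -> B}
  (triangle : forall n x y z, A_ n x -> A_ n y -> A_ n z ->
    S_ n x z <= S_ n x y + S_ n y z)
  (modulus : forall e : K, 0 < e -> exists2 d : K, 0 < d &
    forall n x y, A_ n x -> A_ n y -> mdist x y < d -> S_ n x y < e)
  (pA : forall x, A x -> \forall n \near F, A_ n (p x n))
  (p_cvg : forall x, A x -> p x n @[n --> F] --> x)
  (S_cvg : forall x y, A x -> A y ->
    S_ n (p x n) (p y n) @[n --> F] --> S x y).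

(** By the triangle inequality, [S_ n u v] differs from [S_ n (p x n) (p y n)]
    by at most two small terms. The radius [d] depends on [e] only: this
    uniformity is what the covering argument below consumes. *)
Lemma pointwise_equicontinuous_limit (e : K) : 0 < e -> exists2 d, 0 < d &
  forall x y, A x -> A y -> \forall n \near F, forall u v, A_ n u -> A_ n v ->
    mdist x u < d -> mdist y v < d -> `|S_ n u v - S x y| < e.
Proof.
move=> e0; have e3 : 0 < e / 3 by rewrite divr_gt0.
have [d d0 dP] := modulus _ e3; exists (d / 2); first by rewrite divr_gt0.
move=> x y Ax Ay; have d2 : 0 < d / 2 by rewrite divr_gt0.
near=> n => u v Au Av xu yv.
have Apx : A_ n (p x n) by near: n; exact: pA.
have Apy : A_ n (p y n) by near: n; exact: pA.
have xp : mdist x (p x n) < d / 2.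
  by near: n; exact: (cvg_mdistP _ _).1 (p_cvg _ Ax) _ d2.
have yp : mdist y (p y n) < d / 2.
  by near: n; exact: (cvg_mdistP _ _).1 (p_cvg _ Ay) _ d2.
have Sp : `|S x y - S_ n (p x n) (p y n)| < e / 3.
  by near: n; move/cvgrPdist_lt: (S_cvg _ _ Ax Ay); apply.
have close (z q r : B) :
    mdist z q < d / 2 -> mdist z r < d / 2 -> mdist q r < d.
  move=> zq zr; apply: le_lt_trans (metric_triangle _ z _) _.
  by rewrite metric_sym [ltRHS]splitr ltrD.
have := dP n u (p x n) Au Apx (close _ _ _ xu xp).
have := dP n (p x n) u Apx Au (close _ _ _ xp xu).
have := dP n v (p y n) Av Apy (close _ _ _ yv yp).
have := dP n (p y n) v Apy Av (close _ _ _ yp yv).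
have := triangle _ _ _ _ Au Apx Av; have := triangle _ _ _ _ Apx Apy Av.
have := triangle _ _ _ _ Apx Au Apy; have := triangle _ _ _ _ Au Av Apy.
move: Sp; rewrite !ltr_norml; lra.
Unshelve. all: by end_near. Qed.

(** The pointwise estimate at [(x0, y0)] extends to nearby [(x, y)] once [S] is
    known to vary little there, and compactness of [A `*` A] makes it hold for
    all [(x, y)] at the same indices. *)
Lemma uniform_limit (e : K) : compact A -> 0 < e -> exists2 d, 0 < d &
  \forall n \near F, forall x y u v, A x -> A y -> A_ n u -> A_ n v ->
    mdist x u < d -> mdist y v < d -> `|S_ n u v - S x y| < e.
Proof.
move=> cA e0; have e3 : 0 < e / 3 by rewrite divr_gt0.
have [d d0 dP] := pointwise_equicontinuous_limit _ e3.
have d2 : 0 < d / 2 by rewrite divr_gt0.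
exists (d / 2) => //.
have close (x y z : B) :
    mdist x y < d / 2 -> mdist y z < d / 2 -> mdist x z < d.
  move=> xy yz; apply: le_lt_trans (metric_triangle _ y _) _.
  by rewrite [ltRHS]splitr ltrD.
have d2d : d / 2 < d by lra.
(* Both values of [S] are close to [S_ n (p x n) (p y n)] for some [n]. *)
have S_close x x0 y y0 : A x -> A x0 -> A y -> A y0 -> mdist x0 x < d / 2 ->
    mdist y0 y < d / 2 -> `|S x y - S x0 y0| < 2 * (e / 3).
  move=> Ax Ax0 Ay Ay0 xx0 yy0.
  suff /filter_ex[] : \forall n \near F, `|S x y - S x0 y0| < 2 * (e / 3) by [].
  near=> n.
  have Apx : A_ n (p x n) by near: n; exact: pA.
  have Apy : A_ n (p y n) by near: n; exact: pA.
  have xp : mdist x (p x n) < d / 2.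
    by near: n; exact: (cvg_mdistP _ _).1 (p_cvg _ Ax) _ d2.
  have yp : mdist y (p y n) < d / 2.
    by near: n; exact: (cvg_mdistP _ _).1 (p_cvg _ Ay) _ d2.
  have : `|S_ n (p x n) (p y n) - S x y| < e / 3.
    have xpd := lt_trans xp d2d; have ypd := lt_trans yp d2d.
    move: (p x n) (p y n) Apx Apy xpd ypd {xp yp}.
    by near: n; exact: dP.
  have : `|S_ n (p x n) (p y n) - S x0 y0| < e / 3.
    have xpd := close _ _ _ xx0 xp; have ypd := close _ _ _ yy0 yp.
    move: (p x n) (p y n) Apx Apy xpd ypd {xp yp}.
    by near: n; exact: dP.
  by rewrite !ltr_norml; lra.
pose P n (xy : B * B) := forall u v, A_ n u -> A_ n v ->
  mdist xy.1 u < d / 2 -> mdist xy.2 v < d / 2 -> `|S_ n u v - S xy.1 xy.2| < e.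
have cAA : compact (A `*` A) by exact: compact_setX.
suff : \forall n \near F, A `*` A `<=` P n.
  by apply: filterS => n AP x y u v Ax Ay; exact: (AP (x, y)).
move/compact_near_coveringP/near_covering_withinP : cAA; apply.
move=> [x0 y0] [/= Ax0 Ay0].
exists (ball (x0, y0) (d / 2), [set n | forall u v, A_ n u -> A_ n v ->
    mdist x0 u < d -> mdist y0 v < d -> `|S_ n u v - S x0 y0| < e / 3]).
  by split => /=; [exact: nbhsx_ballx|exact: dP].
move=> [[x y] n] [/= [x0x y0y] nP] [/= Ax Ay] u v Au Av /= xu yv.
rewrite /= ballEmdist/= in x0x; rewrite /= ballEmdist/= in y0y.
have := nP u v Au Av (close _ _ _ x0x xu) (close _ _ _ y0y yv).
have := S_close _ _ _ _ Ax Ax0 Ay Ay0 x0x y0y.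
by rewrite !ltr_norml; lra.
Unshelve. all: by end_near. Qed.

End UniformConvergence.

(** * Compactness of resistance metrics *)

Theorem theorem2p9 (K : realType) (B : metricType K)
    (A_ : nat -> set B) (A : set B)
    (R_ : nat -> B -> B -> K) (psi1 psi2 : K -> K) :
  compact [set: B] ->
  (forall n, compact (A_ n)) ->
  compact A ->
  hausdorff_dist (A_ n) A @[n --> \oo] --> 0%E ->
  (forall n, resistance_metric (A_ n) (R_ n)) ->
  {within `[0, +oo[, continuous psi1} ->
  {within `[0, +oo[, continuous psi2} ->
  psi1 0 = 0 ->
  psi2 0 = 0 ->
  (forall t, 0 < t -> 0 < psi1 t /\ psi1 t <= psi2 t) ->
  (forall n x y, A_ n x -> A_ n y ->
     psi1 (mdist x y) <= R_ n x y /\ R_ n x y <= psi2 (mdist x y)) ->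
  exists (R : B -> B -> K) (n_ : nat -> nat),
    [/\ resistance_metric A R,
        {homo n_ : i j / (i < j)%N},
        res_converges (A_ \o n_) (R_ \o n_) A R
      & forall x y, A x -> A y ->
          psi1 (mdist x y) <= R x y /\ R x y <= psi2 (mdist x y)].
Proof.
move=> _ _ cA AA rR psi1c psi2c psi10 psi20 psi12 Rpsi.
have [U [UU Uoo]] := ultraFilterLemma eventually_filter.
have psi1_ge0 t : 0 <= t -> 0 <= psi1 t.
  by rewrite le_eqVlt => /predU1P[<-|/psi12[/ltW]//]; rewrite psi10.
have R_ge0 n x y : A_ n x -> A_ n y -> 0 <= R_ n x y.
  move=> Ax Ay; apply: le_trans (Rpsi n x y Ax Ay).1.
  exact/psi1_ge0/mdist_ge0.
have R_gt0 n x y : A_ n x -> A_ n y -> x != y -> 0 < R_ n x y.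
  move=> Ax Ay; rewrite -mdist_gt0 => /psi12[psi_gt0 _].
  exact: lt_le_trans psi_gt0 (Rpsi n x y Ax Ay).1.
pose S_ n x y := Num.sqrt (R_ n x y).
have triangle n x y z : A_ n x -> A_ n y -> A_ n z ->
    S_ n x z <= S_ n x y + S_ n y z.
  exact: sqrt_resistance_metric_triangle (rR n) (R_gt0 n).
have modulus e : 0 < e -> exists2 d : K, 0 < d & forall n x y,
    A_ n x -> A_ n y -> mdist x y < d -> S_ n x y < e.
  move=> e0; have e20 : 0 < e ^+ 2 by exact: exprn_gt0.
  have [d d0 dP] := halfline_continuous_near0 psi2 _ psi2c psi20 e20.
  exists d => // n x y Ax Ay xyd.
  rewrite /S_ -[e]gtr0_norm// -sqrtr_sqr ltr_sqrt//.
  by rewrite (le_lt_trans (Rpsi n x y Ax Ay).2)// dP// mdist_ge0.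
have /choice[p pP] x : exists px : nat -> B, A x ->
    (\forall n \near U, A_ n (px n)) /\ px n @[n --> U] --> x.
  have [Ax|nAx] := pselect (A x); last by exists (fun=> x).
  have [px pxA pxx] := hausdorff_cvg_approx _ _ _ AA Ax.
  exists px => _; split; first exact: Uoo.
  by move=> N xN; apply: Uoo; exact: pxx.
have pA x : A x -> \forall n \near U, A_ n (p x n) by move=> /pP[].
have p_cvg x : A x -> p x n @[n --> U] --> x by move=> /pP[].
have d_cvg x y : A x -> A y ->
    mdist (p x n) (p y n) @[n --> U] --> mdist x y.
  by move=> Ax Ay; apply: cvg_mdist; exact: p_cvg.
have psi_cvg (psi : K -> K) x y :
    {within `[0, +oo[, continuous psi} -> A x -> A y ->
    psi (mdist (p x n) (p y n)) @[n --> U] --> psi (mdist x y).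
  move=> psic Ax Ay; apply: cvg_within_halfline => //; last exact: d_cvg.
    exact: mdist_ge0.
  by move=> n; exact: mdist_ge0.
have /choice[R' R'P] (xy : B * B) : exists l : K, A xy.1 -> A xy.2 ->
    R_ n (p xy.1 n) (p xy.2 n) @[n --> U] --> l.
  case: xy => x y /=.
  have [Ax|nAx] := pselect (A x); last by exists 0.
  have [Ay|nAy] := pselect (A y); last by exists 0.
  have [|l lP] := @ultra_bounded_cvg _ _ _ UU
    (fun n => R_ n (p x n) (p y n)) (psi2 (mdist x y) + 1); last by exists l.
  have psi_lt : psi2 (mdist x y) < psi2 (mdist x y) + 1 by rewrite ltrDl.
  have near_psi : \forall n \near U,
      psi2 (mdist (p x n) (p y n)) < psi2 (mdist x y) + 1.
    exact: (cvgr_lt _ (psi_cvg psi2 x y psi2c Ax Ay)).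
  apply: filterS3 (pA _ Ax) (pA _ Ay) near_psi => n Anx Any psin.
  rewrite ger0_norm ?R_ge0//.
  exact: le_trans (Rpsi n _ _ Anx Any).2 (ltW psin).
pose R x y := R' (x, y); pose S x y := Num.sqrt (R x y).
have R_cvg x y : A x -> A y ->
    R_ n (p x n) (p y n) @[n --> U] --> R x y by exact: (R'P (x, y)).
have S_cvg x y : A x -> A y -> S_ n (p x n) (p y n) @[n --> U] --> S x y.
  move=> Ax Ay; apply: continuous_cvg (R_cvg _ _ Ax Ay).
  exact: sqrt_continuous.
have R_bounds x y : A x -> A y ->
    psi1 (mdist x y) <= R x y /\ R x y <= psi2 (mdist x y).
  move=> Ax Ay; have Rxy := R_cvg _ _ Ax Ay.
  split.
    apply: (ler_cvg_to (psi_cvg psi1 x y psi1c Ax Ay) Rxy).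
    apply: filterS2 (pA _ Ax) (pA _ Ay) => n Anx Any.
    exact: (Rpsi n _ _ Anx Any).1.
  apply: (ler_cvg_to Rxy (psi_cvg psi2 x y psi2c Ax Ay)).
  apply: filterS2 (pA _ Ax) (pA _ Ay) => n Anx Any.
  exact: (Rpsi n _ _ Anx Any).2.
have rAR : resistance_metric A R.
  move=> V VA.
  have AV (v : V) : A (val v) by apply: VA; exact: valP.
  apply: (@ultralimit_resistance _ _ U UU _
    (fun n (v w : V) => R_ n (p (val v) n) (p (val w) n))).
  - have near_A : \forall n \near U, forall v : V, A_ n (p (val v) n).
      by apply: filter_forall => v; exact: pA.
    have near_inj : \forall n \near U, forall vw : V * V,
        vw.1 != vw.2 -> p (val vw.1) n != p (val vw.2) n.
      apply: filter_forall => -[v w] /=.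
      have [_|vw] := eqVneq v w; first exact: filterE.
      have d0 : 0 < mdist (val v) (val w) by rewrite mdist_gt0 val_eqE.
      have near_d : \forall n \near U, 0 < mdist (p (val v) n) (p (val w) n).
        exact: (cvgr_gt _ (d_cvg _ _ (AV v) (AV w))).
      by apply: filterS near_d => n; rewrite mdist_gt0.
    apply: filterS2 near_A near_inj => n An pI.
    apply: (resistance_metric_family (fun v : V => p (val v) n) (rR n)) => //.
    move=> v w /eqP pvw; apply/eqP; apply: contraLR pvw => vw.
    exact: (pI (v, w)).
  - by move=> v w; exact: R_cvg.
  - move=> v w vw; have [+ _] := R_bounds _ _ (AV v) (AV w).
    apply: lt_le_trans; apply: (psi12 _ _).1.
    by rewrite mdist_gt0 val_eqE.
(* The radii [d_ j] are fixed before the indices are selected: a sequence that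
   converges to [x] is eventually within each of them. *)
have [d_ d_gt0 d_unif] : exists2 d_ : nat -> K, forall j, 0 < d_ j &
    forall j, \forall n \near U, forall x y u v,
    A x -> A y -> A_ n u -> A_ n v -> mdist x u < d_ j -> mdist y v < d_ j ->
    `|S_ n u v - S x y| < j.+1%:R^-1.
  have /choice[d_ d_P] j : exists d : K, 0 < d /\ \forall n \near U,
      forall x y u v, A x -> A y -> A_ n u -> A_ n v -> mdist x u < d ->
      mdist y v < d -> `|S_ n u v - S x y| < j.+1%:R^-1.
    have j0 : 0 < j.+1%:R^-1 :> K by rewrite invr_gt0.
    have [d d0 dP] := uniform_limit triangle modulus pA p_cvg S_cvg _ cA j0.
    by exists d.
  by exists d_ => j; case: (d_P j).
have [n_ n_homo n_P] := diagonal_subsequence U _ _ Uoo d_unif.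
exists R, n_; split => //.
move=> x y x_ y_ Ax Ay Ax_ Ay_ x_x y_y.
have Sxy : S_ (n_ k) (x_ k) (y_ k) @[k --> \oo] --> S x y.
  apply/cvgrPdist_lt => e e0.
  have [j _ /(_ j (leqnn j)) je] := near_infty_natSinv_lt (PosNum e0).
  have xd : \forall k \near \oo, mdist x (x_ k) < d_ j.
    exact: (cvg_mdistP _ _).1 x_x _ (d_gt0 j).
  have yd : \forall k \near \oo, mdist y (y_ k) < d_ j.
    exact: (cvg_mdistP _ _).1 y_y _ (d_gt0 j).
  apply: filterS3 xd yd (nbhs_infty_ge j) => k xk yk jk.
  rewrite distrC; apply: lt_trans je.
  exact: (n_P j k jk x y _ _ Ax Ay (Ax_ k) (Ay_ k) xk yk).
have R0 : 0 <= R x y.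
  by apply: le_trans (R_bounds _ _ Ax Ay).1; apply/psi1_ge0/mdist_ge0.
rewrite -(sqr_sqrtr R0) expr2; apply: cvg_trans (cvgM Sxy Sxy).
apply: near_eq_cvg; apply: nearW => k /=.
by rewrite -expr2 sqr_sqrtr//; apply: R_ge0; [exact: Ax_|exact: Ay_].
Qed.
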